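(* Let $X$ be a real inner-product space with induced norm $\|\cdot\|$, let $L>0$, and let $f:X\to\mathbb{R}$ be convex and $L$-Lipschitz continuously differentiable, with nonempty solution set $\Omega=\arg\min_{x\in X} f(x)$ and optimal value $f^*=\min_{x\in X} f(x)$. Let $\gamma\in(0,1]$, $C_2\in\left(0,\frac{2-\gamma}{L}\right]$ and $C_1\ge C_2$. Let $x_0\in X$ be arbitrary and let $(x_k)_{k\ge0}$ be generated by $$x_{k+1}=x_k-\alpha_k\nabla f(x_k),\qquad k=0,1,2,\dots,$$ where for every $k\ge 0$ the step size satisfies $\alpha_k\in[C_2,C_1]$ and $$f\left(x_k-\alpha_k\nabla f(x_k)\right)\le f(x_k)-\frac{\gamma\alpha_k}{2}\|\nabla f(x_k)\|^2 .$$ Then $f(x_k)$ converges to $f^*$ at rate $o(1/k)$, that is, $\lim_{k\to\infty}k\,(f(x_k)-f^* )=0$.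
   Context: A function $f:X\to\mathbb{R}$ is $L$-Lipschitz continuously differentiable if it is differentiable with gradient $\nabla f(x)\in X$ at every $x\in X$ (the vector representing the derivative through the inner product) and $\|\nabla f(x)-\nabla f(y)\|\le L\|x-y\|$ for all $x,y\in X$. *)

(* Defs.v *)
From HB Require Import structures.
From mathcomp Require Import all_boot all_order all_algebra.
From mathcomp Require Import all_classical all_reals all_analysis.
Import Order.TTheory GRing.Theory Num.Theory.
Import numFieldNormedType.Exports.

Set Implicit Arguments.
Unset Strict Implicit.
Unset Printing Implicit Defensive.

Local Open Scope classical_set_scope.
Local Open Scope ring_scope.

(* The norm of X is a structure of its own, so it has to be tied to the inner
   product explicitly.  X is not assumed complete nor finite-dimensional. *)
Definition induces_norm (R : realType) (X : normedModType R)
    (ip : {dot X for @idfun R}) : Prop :=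
  forall u : X, `|u| = Num.sqrt (ip u u).

(* f is (Frechet) differentiable everywhere, and its differential at x is
   h |-> ip (g x) h.  On an incomplete X the existence of such a g is an
   assumption on f, not a consequence of differentiability. *)
Definition is_gradient (R : realType) (X : normedModType R)
    (ip : {dot X for @idfun R}) (f : X -> R) (g : X -> X) : Prop :=
  forall x : X, is_diff x (f : X -> R^o) (ip (g x) : X -> R^o).

Definition lipschitz_gradient (R : realType) (X : normedModType R)
    (ip : {dot X for @idfun R}) (L : R) (f : X -> R) (g : X -> X) : Prop :=
  is_gradient ip f g /\ L.-lipschitz g.

Definition argmin (T : Type) (R : realType) (f : T -> R) : set T :=
  [set x | forall y, f x <= f y].

Definition is_minimum (R : realType) (A : set R) (m : R) : Prop :=
  A m /\ lbound A m.

(* Main.v *)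
(* Let s be a minimizer and d_k = f(x_k) - f*. Expanding |x_{k+1} - s|^2,
   convexity bounds the cross term by -2 alpha_k d_k, and the descent condition
   bounds alpha_k^2 |grad f(x_k)|^2 by (2 C1 / gamma) (d_k - d_{k+1}). Hence
   V_k = |x_k - s|^2 + (2 C1 / gamma) d_k satisfies 2 C2 d_k <= V_k - V_{k+1}.
   Since d is nonincreasing, summing over [n/2, n) bounds n d_n by a multiple of
   V_{n/2} - V_n, which tends to 0 because V is nonincreasing and nonnegative. *)
Require Import Defs.
From HB Require Import structures.
From mathcomp Require Import all_boot all_order all_algebra.
From mathcomp Require Import all_classical all_reals all_analysis.
From mathcomp Require Import ring lra zify.
Import Order.TTheory GRing.Theory Num.Theory.
Import numFieldNormedType.Exports.

Set Implicit Arguments.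
Unset Strict Implicit.
Unset Printing Implicit Defensive.

Local Open Scope classical_set_scope.
Local Open Scope ring_scope.

(** For [0 < h <= 1], convexity at [h *: b + (1 - h) *: a] bounds the difference quotient of [f] at
    [a] along [b - a] by [f b - f a]; let [h] tend to 0. *)
Lemma convex_gradient_le (R : realType) (X : normedModType R)
    (ip : {dot X for @idfun R}) (f : X -> R) (g : X -> X) (a b : X) :
  convex_function [set: X] f -> is_gradient ip f g ->
  ip (g a) (b - a) <= f b - f a.
Proof.
move=> cvxf gradf; have diffa := gradf a.
have dfa : differentiable (f : X -> R^o) a by case: diffa.
have drv : derivable (f : X -> R^o) a (b - a) := diff_derivable dfa.
have drvE : 'D_(b - a) (f : X -> R^o) a = ip (g a) (b - a).
  by rewrite deriveE// diff_val.
(* Only the right-hand limit is usable, since [h] has to serve as a convex weight. *)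
rewrite -drvE /derive cvg_at_rightE//.
apply: limr_le.
  by apply/cvg_ex; eexists; apply: cvg_dnbhs_at_right drv.
near=> h.
have h0 : 0 < h by near: h; exact: nbhs_right_gt.
have h1 : h <= 1 by near: h; exact: nbhs_right_le.
have h01 : Itv.spec (@Itv.num_sem R) (Itv.Real `[0, 1]%Z) h.
  by rewrite /Itv.spec/= /Itv.num_sem/= num_real/= in_itv/= (ltW h0).
have := cvxf (Itv.mk h01) b a (in_setT _) (in_setT _).
rewrite convRE /= /conv/=.
rewrite /unstable.onem scalerBl scale1r => cvxh.
have -> : h *: (b - a) + a = h *: b + (a - h *: a).
  by rewrite scalerBr addrAC addrA.
rewrite [leLHS](_ : _ = h^-1 * (f (h *: b + (a - h *: a)) - f a))//.
by rewrite ler_pdivrMl//; lra.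
Unshelve. all: by end_near.
Qed.

(** A form of Olivier's theorem: nonincreasing terms of a convergent series are o(1/n). [V] stands
    in for the remainders, so no series is formed. *)
Lemma mulrn_cvg0_of_telescoping (R : realType) (d V : nat -> R) :
  (forall k, 0 <= d k) -> {homo d : m n / (m <= n)%N >-> n <= m} ->
  (forall k, 0 <= V k) -> (forall k, d k <= V k - V k.+1) ->
  (fun k : nat => k%:R * d k) @ \oo --> (0 : R).
Proof.
move=> d0 d_noninc V0 dV.
have V_noninc : {homo V : m n / (m <= n)%N >-> n <= m}.
  apply/nonincreasing_seqP => k.
  by rewrite -subr_ge0 (le_trans (d0 k)).
have cvgV : cvgn V.
  by apply: nonincreasing_is_cvgn => //; exists 0 => _ [k _ <-].
(* Each of the [n] terms after index [m] dominates the last one, by monotonicity; the induction is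
   on the block length. *)
have sum_le m n : (n%:R * d (m + n)%N <= V m - V (m + n)%N).
  elim: n => [|n IHn]; first by rewrite mul0r addn0 subrr.
  rewrite addnS mulrSr mulrDl mul1r.
  have dn := d_noninc _ _ (leqnSn (m + n)).
  have : n%:R * d (m + n).+1 <= n%:R * d (m + n)%N by rewrite ler_wpM2l.
  by have := dV (m + n)%N; lra.
have cvg_half : V n./2 @[n --> \oo] --> limn V.
  apply: cvg_comp cvgV => A [N _ NA]; exists N.*2 => // n /= Nn.
  by apply: NA => /=; rewrite geq_half_double.
have cvg0 : 2 * (V n./2 - V n) @[n --> \oo] --> (0 : R).
  rewrite -[0](mulr0 2) -(subrr (limn V)).
  by apply: cvgMr; apply: cvgB.
apply: (squeeze_cvgr _ (cvg_cst 0) cvg0).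
near=> n; rewrite mulr_ge0//=.
have nE : (n./2 + uphalf n = n)%N.
  by rewrite addnC uphalf_half -addnA addnn odd_double_half.
have := sum_le n./2 (uphalf n); rewrite nE => le_half.
(* The block from [n./2] to [n] has length [uphalf n], at least half of [n] for either parity; hence
   the factor 2. *)
have : n%:R * d n <= 2 * ((uphalf n)%:R * d n).
  rewrite mulrA ler_wpM2r// -natrM ler_nat.
  by rewrite mul2n uphalf_half; lia.
lra.
Unshelve. all: by end_near.
Qed.

Theorem theorem2 (R : realType) (X : normedModType R)
    (ip : {dot X for @idfun R}) (ip_norm : induces_norm ip)
    (L : R) (L_gt0 : 0 < L)
    (f : X -> R) (gradf : X -> X)
    (f_convex : convex_function [set: X] f)
    (f_grad : lipschitz_gradient ip L f gradf)
    (Omega_nonempty : argmin f !=set0)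
    (fstar : R) (fstarE : is_minimum (range f) fstar)
    (gamma C1 C2 : R)
    (gamma_range : 0 < gamma <= 1)
    (C2_range : 0 < C2 <= (2 - gamma) / L)
    (C1_ge : C2 <= C1)
    (x0 : X) (x : nat -> X) (alpha : nat -> R)
    (x_init : x 0%N = x0)
    (x_step : forall k : nat, x k.+1 = x k - alpha k *: gradf (x k))
    (alpha_range : forall k : nat, C2 <= alpha k <= C1)
    (descent : forall k : nat,
      f (x k - alpha k *: gradf (x k))
        <= f (x k) - gamma * alpha k / 2 * `|gradf (x k)| ^+ 2) :
  (fun k : nat => k%:R * (f (x k) - fstar)) @ \oo --> (0 : R).
Proof.
have [gamma0 _] := andP gamma_range.
have [C20 _] := andP C2_range.
have [gradfP _] := f_grad.
have [[s _ fs] fstar_le] := fstarE.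
pose d k := f (x k) - fstar.
have d0 k : 0 <= d k by rewrite subr_ge0 fstar_le//; exists (x k).
have ip_ge0 u : 0 <= ip u u.
  have [->|u0] := eqVneq u 0; first by rewrite linear0l.
  exact: ltW (neq0_dnorm_gt0 _ u0).
have ip_sqr u : `|u| ^+ 2 = ip u u by rewrite ip_norm sqr_sqrtr.
have dS k : gamma * alpha k / 2 * ip (gradf (x k)) (gradf (x k)) <= d k - d k.+1.
  have := descent k; rewrite -x_step ip_sqr /d; lra.
have d_noninc : {homo d : m n / (m <= n)%N >-> n <= m}.
  apply/nonincreasing_seqP => k; rewrite -subr_ge0; apply: le_trans (dS k).
  have [aC _] := andP (alpha_range k).
  by rewrite !mulr_ge0// ?invr_ge0// ltW// (lt_le_trans C20).
(* Dividing by [2 * C2] makes the decrease of [V] at step [k] at least [d k], with constant 1. *)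
pose V k := (`|x k - s| ^+ 2 + 2 * C1 / gamma * d k) / (2 * C2).
have V0 k : 0 <= V k.
  rewrite divr_ge0 ?mulr_ge0 ?(ltW C20)// addr_ge0 ?sqr_ge0//.
  by rewrite !mulr_ge0 ?invr_ge0// ltW// (lt_le_trans C20).
apply: (@mulrn_cvg0_of_telescoping _ d V) => // k.
have [aC2 aC1] := andP (alpha_range k).
have := convex_gradient_le (x k) s f_convex gradfP.
rewrite fs -opprB linearNr => grad_le.
rewrite /V -mulrBl ler_pdivlMr ?mulr_gt0// x_step.
set a := alpha k in aC2 aC1 *; set u := x k - s in grad_le *.
set g := gradf (x k) in grad_le *.
have -> : x k - a *: g - s = u - a *: g by rewrite addrAC.
have ipC w v : ip w v = ip v w by rewrite hermC expr0 mul1r.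
have Bu : `|u - a *: g| ^+ 2 = `|u| ^+ 2 - 2 * a * ip g u + a ^+ 2 * ip g g.
  rewrite !ip_sqr hnormB expr0 mul1r /= (ipC u) !linearZl_LR linearZr_LR /=.
  rewrite /GRing.scale/=; ring.
(* One factor [a] is absorbed by the descent condition; the other is replaced by [C1], which is
   legitimate because [d k - d k.+1] is nonnegative. *)
have gg : a ^+ 2 * ip g g <= 2 * C1 / gamma * (d k - d k.+1).
  have dd : 0 <= d k - d k.+1 by rewrite subr_ge0 d_noninc.
  have -> : a ^+ 2 * ip g g = 2 * a / gamma * (gamma * a / 2 * ip g g).
    by field; rewrite gt_eqF.
  apply: (@le_trans _ _ (2 * a / gamma * (d k - d k.+1))).
    rewrite ler_wpM2l// ?dS// !mulr_ge0// ?invr_ge0 ?(ltW gamma0)//.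
    exact: ltW (lt_le_trans C20 aC2).
  by rewrite ler_wpM2r// ler_wpM2r ?invr_ge0 ?(ltW gamma0)// ler_wpM2l.
have a0 : 0 < a := lt_le_trans C20 aC2.
(* Here the lower bound on the step size enters, followed by the gradient inequality between [x k]
   and [s]. *)
have dC : d k * C2 <= a * ip g u.
  apply: (@le_trans _ _ (a * d k)); first by rewrite mulrC ler_wpM2r.
  by rewrite ler_pM2l// /d; lra.
rewrite Bu; lra.
Qed.
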